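(* In every induced-$C_4$-free $(2,2)$-coloring of $K_n$ there is a vertex set $U$ with $|U|\ge\lceil 4n/5\rceil$ that has a strong cover, i.e. $U$ is the union of a clique of color $1$ and a clique of color $2$. This is best possible for every $n\ge 5$: for every $n\ge 5$ there is an induced-$C_4$-free $(2,2)$-coloring of $K_n$ in which no set of more than $\lceil 4n/5\rceil$ vertices is the union of a clique of color $1$ and a clique of color $2$.
   Context: A $(2,2)$-coloring of $K_n$ is a representation of its edge set as $E(G_1)\cup E(G_2)$ for two graphs $G_1,G_2$ on $V(K_n)$ (colors $1$ and $2$); an edge may have both colors, and every edge has at least one color. A clique of color $i$ is a vertex set spanning a complete subgraph of $G_i$. The coloring is induced-$C_4$-free if neither $G_1$ nor $G_2$ contains an induced cycle of length $4$. A strong cover of a vertex set $U$ is a covering of $U$ by monochromatic cliques of pairwise different colors. *)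

(* Defs.v *)
From mathcomp Require Import all_boot all_order all_algebra.
Set Implicit Arguments.
Unset Strict Implicit.
Unset Printing Implicit Defensive.

Section Colorings.

Variable T : finType.
Implicit Types (G : rel T) (K U : {set T}).

Definition simple_graph G : Prop := symmetric G /\ irreflexive G.

(* An edge may carry both colors. *)
Definition coloring22 (G1 G2 : rel T) : Prop :=
  [/\ simple_graph G1, simple_graph G2
    & forall x y, x != y -> G1 x y || G2 x y].

Definition clique G K : Prop :=
  forall x y, x \in K -> y \in K -> x != y -> G x y.

Definition induced_C4 G (a b c d : T) : bool :=
  [&& uniq [:: a; b; c; d], G a b, G b c, G c d, G d a,
      ~~ G a c & ~~ G b d].

Definition induced_C4_free G : Prop :=
  forall a b c d, ~~ induced_C4 G a b c d.

Definition C4_free_coloring22 (G1 G2 : rel T) : Prop :=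
  [/\ coloring22 G1 G2, induced_C4_free G1 & induced_C4_free G2].

(* With two colors a strong cover uses at most one clique per color; an unused
   color corresponds to the empty clique. *)
Definition has_strong_cover (G1 G2 : rel T) U : Prop :=
  exists K1 K2 : {set T}, [/\ clique G1 K1, clique G2 K2 & U = K1 :|: K2].

End Colorings.

(* Main.v *)
Require Import Defs.
From mathcomp Require Import all_boot all_order all_algebra.
From mathcomp Require Import zify.
Import Order.TTheory GRing.Theory Num.Theory.
Local Open Scope ring_scope.

(** Let X and Y be the graphs of the pairs having only color 1, resp. only
    color 2.  They are disjoint, and induced-C4-freeness says that neither
    contains an induced 2K2.  A strong cover of U amounts to a 2-coloring of
    the vertices of U in which no X-edge is entirely in color 2 and no Y-edge is
    entirely in color 1.  A vertex with two X-neighbors joined in Y is forced to have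
    color 1, and dually for color 2.  By 2K2-freeness, a Y-neighbor of a vertex
    forced to 1 is itself forced to 2, and conversely, so forced vertices with
    a single forced color never conflict with anything else; unforced vertices can be
    colored greedily.  A vertex forced to both colors lies on a pentagon whose
    edges are X and whose diagonals are Y, and the set of all such vertices is
    a blow-up of one pentagon: deleting its smallest part, of size at most n/5,
    makes it colorable.  Conversely a balanced blow-up of a pentagon is extremal. *)

(** * Exclusive pairs of graphs and forced vertices *)

Section ExclusiveGraphs.

#[local] Set Implicit Arguments.
#[local] Unset Strict Implicit.
#[local] Unset Printing Implicit Defensive.

Variable T : finType.
Implicit Types (X Y : rel T) (K S W D : {set T}).

(* No induced 2K2; when the two edges share a vertex the conclusion is automatic,
   so distinctness need not be required. *)
Definition no_2K2 X : Prop :=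
  forall a b c d, X a b -> X c d -> [|| X a c, X a d, X b c | X b d].

Record exclusive_pair X Y : Prop := ExclusivePair {
  ep_symX : symmetric X;
  ep_symY : symmetric Y;
  ep_irrX : irreflexive X;
  ep_irrY : irreflexive Y;
  ep_disj : forall a b, ~~ (X a b && Y a b);
  ep_2K2X : no_2K2 X;
  ep_2K2Y : no_2K2 Y }.

Lemma exclusive_pair_sym X Y : exclusive_pair X Y -> exclusive_pair Y X.
Proof. by case=> *; split=> // a b; rewrite andbC. Qed.

Definition independent X K : Prop :=
  forall x y, x \in K -> y \in K -> ~~ X x y.

(* With X, Y as in the header: the vertices forced to have color 1. *)
Definition forced X Y (v : T) : bool :=
  [exists a, exists b, [&& X v a, X v b & Y a b]].

Lemma forcedP X Y v :
  reflect (exists a b, [/\ X v a, X v b & Y a b]) (forced X Y v).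
Proof.
apply: (iffP existsP) => [[a /existsP[b /and3P h]]|[a [b /and3P h]]].
  by exists a, b.
by exists a; apply/existsP; exists b.
Qed.

(** Let [a], [b] witness that [w] is forced. Since [w] is joined to both by [X], 2K2-freeness of [Y]
    for [w z] and [a b] joins [z] by [Y] to [a] or [b]; that vertex and [w] force [z]. *)
Lemma forced_neighbor X Y w z :
  exclusive_pair X Y -> forced X Y w -> Y w z -> forced Y X z.
Proof.
move=> ep /forcedP[a [b [wa wb ab]]] wz; apply/forcedP.
have := ep_2K2Y ep wz ab.
have := ep_disj ep w a; rewrite wa /= => /negbTE ->.
have := ep_disj ep w b; rewrite wb /= => /negbTE -> /=.
by case/orP=> h; [exists w, a | exists w, b]; rewrite (ep_symY ep z w).
Qed.

(** Among the four joins between the [X]-edges [u a] and [b w], the pair [a b] lies in [Y], while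
    [X u b] or [X a w] would force [u] or [w]. *)
Lemma unforced_shortcut X Y u a b w : exclusive_pair X Y ->
  ~~ forced X Y u -> ~~ forced X Y w -> X u a -> Y a b -> X b w -> X u w.
Proof.
move=> ep /forcedP nu /forcedP nw ua ab bw.
have := ep_2K2X ep ua bw.
have /negbTE -> : ~~ X a b by have := ep_disj ep a b; rewrite ab andbT.
case/or4P=> // h; first by case: nu; exists a, b.
by case: nw; exists a, b; rewrite !(ep_symX ep w).
Qed.

Lemma unforced_split X Y S : exclusive_pair X Y ->
  (forall v, v \in S -> ~~ forced X Y v && ~~ forced Y X v) ->
  exists K1 K2, [/\ S = K1 :|: K2, independent Y K1 & independent X K2].
Proof.
move=> ep; have [sX sY iX iY _ _ _] := ep.
have [m] := ubnP #|S|; elim: m S => // m IH S Sm Sfree.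
have [->|[v vS]] := set_0Vmem S.
  by exists set0, set0; split=> [|x y|x y]; rewrite ?setU0 ?inE.
(* Coloring [v] with 1 forces [A2], which forces [A1]; nothing else is forced. *)
pose A2 := [set z in S | Y v z].
pose A1 := v |: [set z in S | [exists a in A2, X z a]].
have A1P z : z \in A1 -> z = v \/ z \in S /\ exists2 a, a \in A2 & X z a.
  rewrite !inE => /orP[/eqP|/andP[zS /exists_inP h]]; [by left | by right].
have A2P z : z \in A2 -> z \in S /\ Y v z by rewrite inE => /andP.
have sA1 z : z \in A1 -> z \in S by case/A1P=> [->|[]].
have fY z : z \in S -> ~~ forced Y X z by case/Sfree/andP.
have A2X : independent X A2.
  move=> x y /A2P[xS vx] /A2P[yS vy]; apply/negP => xy.
  by case/forcedP: (fY v vS); exists x, y.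
(* The path [v], [a], [z], [w] alternates [Y], [X], [Y]; the shortcut for the exchanged pair gives
   [Y v w], so propagation ends here. *)
have A1nbr z w : z \in A1 -> w \in S -> Y z w -> w \in A2.
  move=> /A1P[->|[zS [a /A2P[aS va] za]]] wS zw; first by rewrite inE wS.
  rewrite inE wS /=.
  by apply: (unforced_shortcut (exclusive_pair_sym ep) (fY _ vS) (fY _ wS) va _ zw); rewrite sX.
have A1A2 z : z \in A1 -> z \notin A2.
  move=> /A1P[->|[zS [a aA za]]]; first by rewrite inE iY andbF.
  by apply/negP=> zA; have := A2X z a zA aA; rewrite za.
have A1Y : independent Y A1.
  move=> x y xA yA; apply/negP => xy.
  by have := A1A2 y yA; rewrite (A1nbr x y) // sA1.
have [||K1 [K2 [eS iK1 iK2]]] := IH (S :\: (A1 :|: A2)).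
- apply: leq_trans (Sm : (#|S| <= m)%N).
  apply: proper_card; apply/properP; split; first exact: subsetDl.
  by exists v; rewrite // !inE eqxx.
- by move=> z /setDP[zS _]; exact: Sfree.
have sK z : z \in K1 :|: K2 -> [/\ z \in S, z \notin A1 & z \notin A2].
  by rewrite -eS 2!inE negb_or => /andP[/andP[-> ->] ->].
exists (A1 :|: K1), (A2 :|: K2); split.
- rewrite setUACA -eS; apply/setP=> z; rewrite in_setU in_setD.
  by case: (boolP (z \in A1 :|: A2)) => //= /setUP[/sA1|/A2P[]].
- have cross x y : x \in A1 -> y \in K1 -> ~~ Y x y.
    move=> xA yK; have [|yS _ yA] := sK y; first by rewrite inE yK.
    by apply: contra yA => /(A1nbr _ _ xA yS).
  move=> x y /setUP[xA|xK] /setUP[yA|yK]; [exact: A1Y|exact: cross| |exact: iK1].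
  by rewrite sY cross.
- have cross x y : x \in A2 -> y \in K2 -> ~~ X x y.
    move=> xA yK; have [|yS yA _] := sK y; first by rewrite inE yK orbT.
    apply: contra yA => xy; rewrite !inE yS; apply/orP; right.
    by apply/exists_inP; exists x; rewrite // sX.
  move=> x y /setUP[xA|xK] /setUP[yA|yK]; [exact: A2X|exact: cross| |exact: iK2].
  by rewrite sX cross.
Qed.

(** * Pentagons and doubly forced vertices *)

Definition pentagon X Y (a b c d e : T) : bool :=
  [&& X a b, X b c, X c d, X d e & X e a]
  && [&& Y a c, Y c e, Y e b, Y b d & Y d a].

Lemma pentagon_rot X Y a b c d e :
  pentagon X Y a b c d e -> pentagon X Y b c d e a.
Proof.
by move=> /andP[/and5P[? ? ? ? ?] /and5P[? ? ? ? ?]]; do ![apply/andP; split].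
Qed.

Lemma pentagon_dual X Y a b c d e : exclusive_pair X Y ->
  pentagon X Y a b c d e -> pentagon Y X a c e b d.
Proof.
move=> ep /andP[/and5P[? ? ? ? ?] /and5P[? ? ? ? ?]].
by do ![apply/andP; split] => //; rewrite (ep_symX ep).
Qed.

Lemma forced_both_pentagon X Y v : exclusive_pair X Y ->
  forced X Y v -> forced Y X v -> exists a b c d, pentagon X Y v a b c d.
Proof.
move=> ep /forcedP[p [q [vp vq pq]]] /forcedP[r [s [vr vs rs]]].
have [sX sY _ _ dis tX tY] := ep.
(* Each of [p], [q] has an [X]-neighbor in [r], [s], and each of [r], [s] a [Y]-neighbor in [p],
   [q]. So both graphs are perfect matchings between the two pairs, and [X p r] or [X p s] fixes the
   pentagon. *)
move: (tX _ _ _ _ vp rs) (tX _ _ _ _ vq rs) (tY _ _ _ _ vr pq) (tY _ _ _ _ vs pq).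
move: (dis v p) (dis v q) (dis v r) (dis v s) (dis p r) (dis p s) (dis q r) (dis q s).
rewrite vp vq vr vs !(sY r) !(sY s) /= ?andbT => /negbTE -> /negbTE -> /negbTE -> /negbTE -> /=.
move=> dpr dps dqr dqs h1 h2 h3 h4.
case: (boolP (X p r)) => pr.
  exists p, r, s, q; rewrite /pentagon vp pr rs vr (sX q v) vq (sX s q) (sY r q) (sY q p) pq (sY s v) vs.
  by move: pr dpr dps dqr dqs h1 h2 h3 h4; case: (X p r); case: (X p s); case: (X q r);
    case: (X q s); case: (Y p r); case: (Y p s); case: (Y q r); case: (Y q s).
exists p, s, r, q; rewrite /pentagon vp (sX s r) rs vs (sX q v) vq (sX r q) (sY s q) (sY q p) pq (sY r v) vr.
by move: pr dpr dps dqr dqs h1 h2 h3 h4; case: (X p r); case: (X p s); case: (X q r);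
    case: (X q s); case: (Y p r); case: (Y p s); case: (Y q r); case: (Y q s).
Qed.

(* [v] sees the pentagon exactly as its vertex [a] does. *)
Definition twin X Y v (a b c d e : T) : bool :=
  [&& ~~ X v a, ~~ Y v a, X v b, X v e, Y v c & Y v d].

(** Each conjunct is 2K2-freeness for an edge from [v] to a vertex of the pentagon and the side
    opposite that vertex. *)
Lemma pentagon_attach X Y a b c d e v : exclusive_pair X Y ->
  pentagon X Y a b c d e ->
  [&& X v a ==> X v c || X v d, X v b ==> X v d || X v e,
      X v c ==> X v e || X v a, X v d ==> X v a || X v b
    & X v e ==> X v b || X v c].
Proof.
move=> ep /andP[/and5P[ab bc cd de ea] /and5P[ac ce eb bd da]].
have nX x y : Y x y -> X x y = false /\ X y x = false.
  by rewrite [X y x](ep_symX ep) => xy; have := ep_disj ep x y; rewrite xy andbT => /negbTE.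
have tX x y z : X v x -> X y z -> X x y = false -> X x z = false -> X v y || X v z.
  by move=> vx yz xy xz; have := ep_2K2X ep vx yz; rewrite xy xz !orbF.
have [] := (nX _ _ ac, nX _ _ ce, nX _ _ eb, nX _ _ bd, nX _ _ da).
move=> [[[[ac1 ca1] [ce1 ec1]] [eb1 be1]] [bd1 db1]] [da1 ad1].
apply/and5P; split; apply/implyP=> h; exact: (tX _ _ _ h).
Qed.

Lemma pentagon_trichotomy X Y a b c d e v : exclusive_pair X Y ->
  pentagon X Y a b c d e ->
  [|| [|| twin X Y v a b c d e, twin X Y v b c d e a, twin X Y v c d e a b,
          twin X Y v d e a b c | twin X Y v e a b c d],
      ~~ has (X v) [:: a; b; c; d; e] | ~~ has (Y v) [:: a; b; c; d; e]].
Proof.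
move=> ep P; have := pentagon_attach v ep P.
have := pentagon_attach v (exclusive_pair_sym ep) (pentagon_dual ep P).
move: (ep_disj ep v a) (ep_disj ep v b) (ep_disj ep v c) (ep_disj ep v d) (ep_disj ep v e).
rewrite /twin /=; case: (X v a); case: (X v b); case: (X v c); case: (X v d); case: (X v e);
  by case: (Y v a); case: (Y v b); case: (Y v c); case: (Y v d); case: (Y v e).
Qed.

Lemma Y_neighbor_no_X X Y a b c d e v w : exclusive_pair X Y ->
  pentagon X Y a b c d e -> ~~ has (Y v) [:: a; b; c; d; e] -> Y v w ->
  ~~ has (X w) [:: a; b; c; d; e].
Proof.
move=> ep P; rewrite /= !negb_or => /and5P[va vb vc vd /andP[ve _]] vw.
(* Thus no diagonal has both ends [X]-joined to [w], but [pentagon_attach] would produce such a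
   diagonal from any [X]-neighbor. *)
have tY x y : ~~ Y v x -> ~~ Y v y -> Y x y -> Y w x || Y w y.
  by move=> /negbTE vx /negbTE vy /(ep_2K2Y ep vw); rewrite vx vy.
have := pentagon_attach w ep P; move: P => /andP[_ /and5P[ac ce eb bd da]].
move: (tY a c va vc ac) (tY c e vc ve ce) (tY e b ve vb eb) (tY b d vb vd bd) (tY d a vd va da).
move: (ep_disj ep w a) (ep_disj ep w b) (ep_disj ep w c) (ep_disj ep w d) (ep_disj ep w e).
case: (X w a); case: (X w b); case: (X w c); case: (X w d); case: (X w e);
  by case: (Y w a); case: (Y w b); case: (Y w c); case: (Y w d); case: (Y w e).
Qed.

Lemma no_Y_not_forced X Y a b c d e v : exclusive_pair X Y ->
  pentagon X Y a b c d e -> ~~ has (Y v) [:: a; b; c; d; e] ->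
  ~~ forced Y X v.
Proof.
move=> ep P nv; apply/forcedP => -[p [q [vp vq pq]]].
have /andP[/and5P[ab _ _ _ _] _] := P.
have := Y_neighbor_no_X ep P nv vp; have := Y_neighbor_no_X ep P nv vq.
rewrite /= !negb_or => /and3P[/negbTE qa /negbTE qb _] /and3P[/negbTE pa /negbTE pb _].
(* Neither [p] nor [q] has an [X]-neighbor on the pentagon, so [p q] and the side [a b] would be an
   induced 2K2. *)
by have := ep_2K2X ep pq ab; rewrite qa qb pa pb.
Qed.

Lemma forced_both_twin X Y a b c d e v : exclusive_pair X Y ->
  pentagon X Y a b c d e -> forced X Y v -> forced Y X v ->
  [|| twin X Y v a b c d e, twin X Y v b c d e a, twin X Y v c d e a b,
      twin X Y v d e a b c | twin X Y v e a b c d].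
Proof.
move=> ep P fX fY; have := pentagon_trichotomy v ep P.
case/or3P=> // h.
  have h' : ~~ has (X v) [:: a; c; e; b; d].
    by move: h; rewrite /= !negb_or => /and5P[-> -> -> -> /andP[->]].
  by have := no_Y_not_forced (exclusive_pair_sym ep) (pentagon_dual ep P) h'; rewrite fX.
by have := no_Y_not_forced ep P h; rewrite fY.
Qed.

Lemma pentagon_replace X Y a b c d e u : exclusive_pair X Y ->
  pentagon X Y a b c d e -> twin X Y u a b c d e -> pentagon X Y u b c d e.
Proof.
move=> ep /andP[/and5P[_ bc cd de _] /and5P[_ ce eb bd _]] /and5P[_ _ ub ue /andP[uc ud]].
by rewrite /pentagon ub bc cd de (ep_symX ep) ue uc ce eb bd (ep_symY ep) ud.
Qed.

(** With [u] replacing [a] in the pentagon, [v] is a twin of one of its vertices; the joins of [v]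
    to [b], [c], [d], [e] leave only [u]. *)
Lemma twin_same X Y a b c d e u v : exclusive_pair X Y ->
  pentagon X Y a b c d e -> forced X Y v -> forced Y X v ->
  twin X Y u a b c d e -> twin X Y v a b c d e -> ~~ X v u && ~~ Y v u.
Proof.
move=> ep P fX fY /(pentagon_replace ep P) P' /and5P[_ _ vb ve /andP[vc vd]].
have := forced_both_twin ep P' fX fY.
have := ep_disj ep v c; have := ep_disj ep v d; rewrite /twin vb ve vc vd !andbT.
by move=> /negbTE -> /negbTE ->; case: (X v u); case: (Y v u); rewrite //= ?andbF.
Qed.

Lemma twin_next X Y a b c d e u v : exclusive_pair X Y ->
  pentagon X Y a b c d e -> forced X Y v -> forced Y X v ->
  twin X Y u a b c d e -> twin X Y v b c d e a -> ~~ Y v u.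
Proof.
move=> ep P fX fY /(pentagon_replace ep P) P' /and5P[_ _ vc va /andP[vd ve]].
have := forced_both_twin ep P' fX fY; have := ep_disj ep v u.
have := ep_disj ep v d; have := ep_disj ep v e; rewrite /twin vc vd ve !andbT.
by move=> /negbTE -> /negbTE ->; case: (X v u); case: (Y v u); rewrite //= ?andbF.
Qed.

Lemma twin_dual X Y v a b c d e :
  twin X Y v a b c d e -> twin Y X v a c e b d.
Proof. by rewrite /twin => /and5P[-> -> -> -> /andP[-> ->]]. Qed.

(* The part of [a] in the blow-up of the pentagon formed by the doubly forced
   vertices. *)
Definition part X Y (a b c d e : T) : {set T} :=
  [set v | [&& forced X Y v, forced Y X v & twin X Y v a b c d e]].

Lemma part_dual X Y a b c d e v :
  v \in part X Y a b c d e -> v \in part Y X a c e b d.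
Proof. by rewrite !inE => /and3P[-> -> /twin_dual]. Qed.

Lemma independent_parts X Y a b c d e : exclusive_pair X Y ->
  pentagon X Y a b c d e ->
  independent Y (part X Y a b c d e :|: part X Y b c d e a).
Proof.
move=> ep P x y.
have same p q r s t u v : pentagon X Y p q r s t -> u \in part X Y p q r s t ->
    v \in part X Y p q r s t -> ~~ Y u v.
  rewrite !inE => Q /and3P[fX fY tu] /and3P[_ _ tv].
  by case/andP: (twin_same ep Q fX fY tv tu).
have cross u v : u \in part X Y a b c d e -> v \in part X Y b c d e a -> ~~ Y u v.
  rewrite !inE => /and3P[_ _ tu] /and3P[fX fY tv].
  by rewrite (ep_symY ep) (twin_next ep P).
case/setUP=> hx /setUP[] hy.
- exact: same P hx hy.
- exact: cross.
- by rewrite (ep_symY ep) cross.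
- exact: same (pentagon_rot P) hx hy.
Qed.

(** * Assembling the vertex coloring *)

Lemma independent_forcedU X Y K1 W1 : exclusive_pair X Y ->
  (forall v, v \in K1 -> ~~ forced X Y v && ~~ forced Y X v) ->
  (forall v, v \in W1 -> forced X Y v && forced Y X v) ->
  independent Y K1 -> independent Y W1 ->
  independent Y ([set v | forced X Y v && ~~ forced Y X v] :|: (K1 :|: W1)).
Proof.
move=> ep nK fW iK iW; set A := _ :|: _ => x y xA yA; apply/negP=> xy.
have yx : Y y x by rewrite (ep_symY ep).
have inW z : z \in A ->
    forced Y X z -> z \in W1.
  by rewrite !inE => /or3P[/andP[_ /negbTE ->]|/nK/andP[_ /negbTE ->]|].
have key z w : w \in A ->
    Y z w -> forced X Y z -> w \in W1.
  by move=> wA zw fz; apply: inW wA _; apply: forced_neighbor zw.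
(* If one end of a [Y]-edge in [A] is forced to 1, the other is forced to 2, hence lies in [W1] and
   is doubly forced; then the first end lies in [W1] too, against independence. So both ends lie in
   [K1]. *)
have both z w : z \in A ->
    w \in A ->
    Y z w -> Y w z -> ~~ forced X Y z.
  move=> zA wA zw wz; apply/negP=> fz.
  have wW := key _ _ wA zw fz; have /andP[fw _] := fW _ wW.
  by have := iW _ _ (key _ _ zA wz fw) wW; rewrite zw.
have inK z : z \in A ->
    ~~ forced X Y z -> z \in K1.
  by rewrite !inE => /or3P[/andP[->]||/fW/andP[->]].
have := iK _ _ (inK _ xA (both _ _ xA yA xy yx)) (inK _ yA (both _ _ yA xA yx xy)).
by rewrite xy.
Qed.

Lemma split_setC X Y W1 W2 D : exclusive_pair X Y ->
  [set v | forced X Y v && forced Y X v] :\: D = W1 :|: W2 ->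
  (forall v, v \in D -> forced X Y v && forced Y X v) ->
  independent Y W1 -> independent X W2 ->
  exists K1 K2, [/\ independent Y K1, independent X K2 & ~: D = K1 :|: K2].
Proof.
move=> ep eW sD iW1 iW2.
have [v|K1 [K2 [eK iK1 iK2]]] := @unforced_split X Y
  [set v | ~~ forced X Y v && ~~ forced Y X v] ep; first by rewrite inE.
have WP v : v \in W1 :|: W2 -> forced X Y v && forced Y X v.
  by rewrite -eW => /setDP[]; rewrite inE.
have KP v : v \in K1 :|: K2 -> ~~ forced X Y v && ~~ forced Y X v.
  by rewrite -eK inE.
exists ([set v | forced X Y v && ~~ forced Y X v] :|: (K1 :|: W1)),
  ([set v | forced Y X v && ~~ forced X Y v] :|: (K2 :|: W2)); split.
- by apply: independent_forcedU => // v h; [apply: KP | apply: WP]; rewrite inE h.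
- apply: independent_forcedU => //; first exact: exclusive_pair_sym.
    by move=> v h; rewrite andbC KP // inE h orbT.
  by move=> v h; rewrite andbC WP // inE h orbT.
- rewrite setUACA (setUACA K1) -eK -eW; apply/setP=> v; rewrite !inE.
  by have := sD v; case: (v \in D) => [/(_ isT)/andP[-> ->]|_] //;
    case: (forced X Y v); case: (forced Y X v).
Qed.

Lemma pentagon_split X Y a b c d e : exclusive_pair X Y ->
  pentagon X Y a b c d e ->
  exists K1 K2, [/\ independent Y K1, independent X K2
                  & ~: part X Y a b c d e = K1 :|: K2].
Proof.
move=> ep P.
have P1 := pentagon_rot P; have P2 := pentagon_rot P1.
have P4 := pentagon_rot (pentagon_rot P2).
(* With the part of [a] deleted, color 1 takes the parts of the side [c d] and color 2 those of the
   diagonal [e b], a side of the dual pentagon. *)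
apply: (@split_setC X Y (part X Y c d e a b :|: part X Y d e a b c)
   (part X Y e a b c d :|: part X Y b c d e a)) => //.
- apply/setP=> v; rewrite !inE.
  case: (boolP (forced X Y v)) => fX; last by rewrite ?andbF.
  case: (boolP (forced Y X v)) => fY; last by rewrite ?andbF.
  have := forced_both_twin ep P fX fY; rewrite /twin /=.
  move: (ep_disj ep v a) (ep_disj ep v b) (ep_disj ep v c) (ep_disj ep v d) (ep_disj ep v e).
  case: (X v a); case: (X v b); case: (X v c); case: (X v d); case: (X v e);
    by case: (Y v a); case: (Y v b); case: (Y v c); case: (Y v d); case: (Y v e).
- by move=> v; rewrite inE => /and3P[-> ->].
- exact: independent_parts.
- have := independent_parts (exclusive_pair_sym ep) (pentagon_dual ep P4).
  move=> iP x y hx hy; apply: iP.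
    by case/setUP: hx => /part_dual h; rewrite inE h ?orbT.
  by case/setUP: hy => /part_dual h; rewrite inE h ?orbT.
Qed.

(** A twin of one of the five vertices is not joined to it but is joined to the other four, so the
    parts are disjoint. *)
Lemma part_card X Y a b c d e : exclusive_pair X Y ->
  (#|part X Y a b c d e| + #|part X Y b c d e a| + #|part X Y c d e a b|
   + #|part X Y d e a b c| + #|part X Y e a b c d| <= #|T|)%N.
Proof.
move=> ep; rewrite -!sum1_card !(big_mkcond (mem (part _ _ _ _ _ _ _))) /=.
rewrite [X in (_ <= X)%N](big_mkcond predT) -!big_split /=; apply: leq_sum => v _.
rewrite !inE; case: (forced X Y v); case: (forced Y X v) => //=; rewrite /twin.
move: (ep_disj ep v a) (ep_disj ep v b) (ep_disj ep v c) (ep_disj ep v d) (ep_disj ep v e).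
case: (X v a); case: (X v b); case: (X v c); case: (X v d); case: (X v e);
  by case: (Y v a); case: (Y v b); case: (Y v c); case: (Y v d); case: (Y v e).
Qed.

Lemma large_split X Y : exclusive_pair X Y ->
  exists D K1 K2 : {set T}, [/\ (5 * #|D| <= #|T|)%N, independent Y K1,
    independent X K2 & ~: D = K1 :|: K2].
Proof.
move=> ep; have [W0|[v]] := set_0Vmem [set v | forced X Y v && forced Y X v].
  have [||||K1 [K2 [i1 i2 e]]] := @split_setC X Y set0 set0 set0 ep.
  - by rewrite W0 setD0 setU0.
  - by move=> v; rewrite inE.
  - by move=> x y; rewrite inE.
  - by move=> x y; rewrite inE.
  by exists set0, K1, K2; rewrite cards0.
rewrite inE => /andP[fX fY]; have [a [b [c [d P]]]] := forced_both_pentagon ep fX fY.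
have P1 := pentagon_rot P; have P2 := pentagon_rot P1; have P3 := pentagon_rot P2.
have P4 := pentagon_rot P3.
have small p q r s t : pentagon X Y p q r s t ->
    (5 * #|part X Y p q r s t| <= #|T|)%N -> exists D K1 K2 : {set T},
    [/\ (5 * #|D| <= #|T|)%N, independent Y K1, independent X K2 & ~: D = K1 :|: K2].
  by move=> Q le; have [K1 [K2 [? ? ?]]] := pentagon_split ep Q; exists (part X Y p q r s t), K1, K2.
have := part_card v a b c d ep.
case: (leqP (5 * #|part X Y v a b c d|) #|T|) => [/(small _ _ _ _ _ P)//|h0].
case: (leqP (5 * #|part X Y a b c d v|) #|T|) => [/(small _ _ _ _ _ P1)//|h1].
case: (leqP (5 * #|part X Y b c d v a|) #|T|) => [/(small _ _ _ _ _ P2)//|h2].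
case: (leqP (5 * #|part X Y c d v a b|) #|T|) => [/(small _ _ _ _ _ P3)//|h3].
case: (leqP (5 * #|part X Y d v a b c|) #|T|) => [/(small _ _ _ _ _ P4)//|h4].
lia.
Qed.

End ExclusiveGraphs.

(** * From colorings to exclusive pairs *)

Lemma exclusive_pair_coloring {T : finType} {G1 G2 : rel T} :
  C4_free_coloring22 G1 G2 ->
  exclusive_pair (fun x y => (x != y) && ~~ G2 x y) (fun x y => (x != y) && ~~ G1 x y).
Proof.
move=> [[[s1 i1] [s2 i2] tot] f1 f2].
have key G : symmetric G -> induced_C4_free G -> no_2K2 (fun x y => (x != y) && ~~ G x y).
  move=> sG fG a b c d /andP[ab nab] /andP[cd ncd]; apply/negPn; apply/negP => h.
  move: h; rewrite !negb_or !negb_and !negbK => /and4P[ac ad bc bd].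
  (* Each cross pair is equal or adjacent in [G]. An equality would turn another cross pair into the
     non-edge [a b], so [a], [c], [b], [d] is an induced 4-cycle. *)
  have nac : a != c by apply: contraNneq nab => e; move: bc; rewrite -e eq_sym (negbTE ab) sG.
  have nad : a != d by apply: contraNneq nab => e; move: bd; rewrite -e eq_sym (negbTE ab) sG.
  have nbc : b != c by apply: contraNneq nab => e; move: ac; rewrite -e (negbTE ab).
  have nbd : b != d by apply: contraNneq nab => e; move: ad; rewrite -e (negbTE ab).
  have := fG a c b d; rewrite /induced_C4 /= !inE (sG c b) (sG d a) nab ncd.
  rewrite (negbTE ab) (negbTE cd) (eq_sym c b) !(negbTE nac, negbTE nad, negbTE nbc, negbTE nbd) /=.
  by move: ac ad bc bd; rewrite !(negbTE nac, negbTE nad, negbTE nbc, negbTE nbd) /= => -> -> -> ->.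
split; try exact: key.
- by move=> x y; rewrite eq_sym s2.
- by move=> x y; rewrite eq_sym s1.
- by move=> x; rewrite eqxx.
- by move=> x; rewrite eqxx.
- move=> x y; have := tot x y; case: (x == y) => //= /(_ isT).
  by case: (G1 x y); case: (G2 x y).
Qed.

(** * Ceilings and the extremal coloring *)

Lemma ceil_le_nat (n m : nat) :
  (Num.ceil (4 * n%:R / 5 : rat) <= m%:Z) = (4 * n <= 5 * m)%N.
Proof.
rewrite ceil_le_int ler_pdivrMr // -[m%:Z%:~R]/(m%:R) -!natrM ler_nat.
by rewrite (mulnC m).
Qed.

Lemma ceil_lt_nat (n m : nat) :
  (Num.ceil (4 * n%:R / 5 : rat) < m%:Z) = (4 * n + 5 <= 5 * m)%N.
Proof.
rewrite -lezD1 -lerBrDr ceil_le_int ler_pdivrMr // intrB mulrBl mul1r lerBrDr.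
by rewrite -pmulrn -!natrM -natrD ler_nat (mulnC m).
Qed.

(* Colors of the pairs in the blow-up of the pentagon, the part of a vertex being
   its residue mod 5; pairs inside a part get both colors. *)
Definition cyc_color1 (i j : nat) : bool := ((i + 5 - j) %% 5)%N \in [:: 0; 1; 4]%N.
Definition cyc_color2 (i j : nat) : bool := ((i + 5 - j) %% 5)%N \in [:: 0; 2; 3]%N.

Definition mod5_rel (g : rel nat) n : rel 'I_n :=
  fun x y => (x != y) && g (x %% 5)%N (y %% 5)%N.

(** Reduces claims about all vertices to a computation on the five residues. *)
Lemma mod5_all (p : pred nat) (x : nat) : all p (iota 0 5) -> p (x %% 5)%N.
Proof. by move/allP; apply; rewrite mem_iota ltn_pmod. Qed.

Lemma mod5_rel_C4_free (g : rel nat) n :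
  all (fun i => all (fun j => all (fun k => all (fun l =>
    ~~ [&& g i j, g j k, g k l, g l i, ~~ g i k & ~~ g j l])
    (iota 0 5)) (iota 0 5)) (iota 0 5)) (iota 0 5) ->
  induced_C4_free (mod5_rel g n).
Proof.
move=> h a b c d; apply/negP; rewrite /induced_C4 /mod5_rel.
case/and5P=> uq /andP[_ ab] /andP[_ bc] /andP[_ cd] /and3P[/andP[_ da]].
move: uq; rewrite /= !inE !negb_or => /and4P[/and3P[_ -> _] /andP[_ ->] _ _] /= ac bd.
(* Distinct vertices may share a residue, so [h] ranges over all quadruples, repetitions
   included. *)
have := mod5_all _ d (mod5_all _ c (mod5_all _ b (mod5_all _ a h))).
by rewrite ab bc cd da ac bd.
Qed.

Lemma mod5_C4_free_coloring n :
  C4_free_coloring22 (mod5_rel cyc_color1 n) (mod5_rel cyc_color2 n).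
Proof.
have sim (g : rel nat) :
    all (fun i => all (fun j => g i j == g j i) (iota 0 5)) (iota 0 5) ->
    simple_graph (mod5_rel g n).
  move=> h; split=> [x y|x]; last by rewrite /mod5_rel eqxx.
  by rewrite /mod5_rel eq_sym (eqP (mod5_all _ y (mod5_all _ x h))).
split; [split; [exact: sim|exact: sim|] | exact: mod5_rel_C4_free | exact: mod5_rel_C4_free].
move=> x y nxy; rewrite /mod5_rel nxy /=.
pose p i := all (fun j => cyc_color1 i j || cyc_color2 i j) (iota 0 5).
exact: mod5_all (fun j => cyc_color1 (x %% 5)%N j || cyc_color2 (x %% 5)%N j) y (mod5_all p x isT).
Qed.

(* A clique of one color meets at most two of the five parts. *)
Lemma mod5_cover_misses {n} {K1 K2 : {set 'I_n}} :
  clique (mod5_rel cyc_color1 n) K1 -> clique (mod5_rel cyc_color2 n) K2 ->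
  exists2 r, (r < 5)%N & forall x, x \in K1 :|: K2 -> (x %% 5)%N != r.
Proof.
move=> c1 c2.
pose hit (K : {set 'I_n}) r := [exists x in K, x %% 5 == r]%N.
have hitP g K r s : clique (mod5_rel g n) K -> r != s -> ~~ g r s ->
    ~~ (hit K r && hit K s).
  move=> cK rs; apply: contra => /andP[/exists_inP[x xK /eqP xr] /exists_inP[y yK /eqP ys]].
  have nxy : x != y by apply: contraNneq rs => e; rewrite -xr -ys e.
  by have := cK x y xK yK nxy; rewrite /mod5_rel nxy xr ys.
(* Five excluded pairs of residues per color leave each clique at most two residues, hence at most
   four of the five in all. *)
have : has (fun r => ~~ (hit K1 r || hit K2 r)) (iota 0 5).
  have h1 r s := hitP _ _ r s c1; have h2 r s := hitP _ _ r s c2; rewrite /=.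
  move: (h1 0 2 isT isT)%N (h1 1 3 isT isT)%N (h1 2 4 isT isT)%N (h1 3 0 isT isT)%N.
  move: (h1 4 1 isT isT)%N (h2 0 1 isT isT)%N (h2 1 2 isT isT)%N (h2 2 3 isT isT)%N.
  move: (h2 3 4 isT isT)%N (h2 4 0 isT isT)%N.
  case: (hit K1 0%N); case: (hit K1 1%N); case: (hit K1 2%N); case: (hit K1 3%N);
    case: (hit K1 4%N); case: (hit K2 0%N); case: (hit K2 1%N); case: (hit K2 2%N);
    by case: (hit K2 3%N); case: (hit K2 4%N).
case/hasP=> r; rewrite mem_iota => r5 nr; exists r => // x; rewrite inE => xK.
apply: contra nr => xr.
by case/orP: xK => xK; apply/orP; [left | right]; apply/exists_inP; exists x.
Qed.

Lemma card_mod5_neq n r : (r < 5)%N ->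
  (#|[set x : 'I_n | x %% 5 != r]%N| <= n - n %/ 5)%N.
Proof.
move=> r5.
(* The numbers [5 * k + r] with [k < n %/ 5] already give enough vertices of residue [r]. *)
have lt (k : 'I_(n %/ 5)) : (5 * k + r < n)%N by have := ltn_ord k; lia.
pose f k := Ordinal (lt k).
have f_inj : injective f by move=> j k /(congr1 val) /= e; apply: val_inj => /=; lia.
have := cardsC [set x : 'I_n | x %% 5 != r]%N; rewrite card_ord.
suff : (n %/ 5 <= #|~: [set x : 'I_n | x %% 5 != r]%N|)%N by lia.
rewrite -[X in (X <= _)%N]card_ord -cardsT -(card_imset _ f_inj).
apply: subset_leq_card; apply/subsetP=> _ /imsetP[k _ ->].
by rewrite !inE negbK /=; apply/eqP; lia.
Qed.

Theorem theorem1p8 (n : nat) :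
  (forall G1 G2 : rel 'I_n, C4_free_coloring22 G1 G2 ->
     exists U : {set 'I_n},
       Num.ceil (4 * n%:R / 5 : rat) <= #|U|%:Z /\ has_strong_cover G1 G2 U) /\
  ((5 <= n)%N ->
     exists G1 G2 : rel 'I_n, C4_free_coloring22 G1 G2 /\
       forall U : {set 'I_n},
         Num.ceil (4 * n%:R / 5 : rat) < #|U|%:Z -> ~ has_strong_cover G1 G2 U).
Proof.
split=> [G1 G2 col|_].
  have [D [K1 [K2 [D5 i1 i2 eK]]]] := large_split (exclusive_pair_coloring col).
  exists (~: D); split.
    rewrite card_ord in D5; have := cardsC D; rewrite card_ord ceil_le_nat => cD.
    by rewrite -(leq_add2l (5 * #|D|)) -mulnDr cD; lia.
  exists K1, K2; split=> // x y xK yK nxy.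
    by have := i1 x y xK yK; rewrite nxy negbK.
  by have := i2 x y xK yK; rewrite nxy negbK.
exists (mod5_rel cyc_color1 n), (mod5_rel cyc_color2 n).
split=> [|U ltU [K1 [K2 [c1 c2 eU]]]]; first exact: mod5_C4_free_coloring.
have [r r5 miss] := mod5_cover_misses c1 c2.
(* [n - n %/ 5] is exactly the ceiling of [4 * n / 5]. *)
have leU : (#|U| <= n - n %/ 5)%N.
  apply: leq_trans (card_mod5_neq n _ r5); apply: subset_leq_card.
  by apply/subsetP=> x; rewrite eU => xU; rewrite inE miss.
by move: ltU; rewrite ceil_lt_nat; lia.
Qed.
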